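(* Let $\mathbf{r}: S^1\to\mathbb{R}^2$ be a $C^\infty$ immersion whose no-silhouette $\mathcal{NS}_{\mathbf{r}}$ is non-empty, and let $\theta_{\mathbf{r}}$ be its aperture angle. Suppose that $\mathbf{r}$ has no inflection points. Then, for any two $\theta_1,\theta_2$ satisfying $0\le\theta_1<\theta_2<\theta_{\mathbf{r}}$, the following inclusion holds: $$\mathcal{NS}_{\theta_1,\mathbf{r}}\supset\mathcal{NS}_{\theta_2,\mathbf{r}}.$$
   Context: Let $\mathbf{r}: S^1\to\mathbb{R}^2$ be a $C^\infty$ immersion. For $s\in S^1$, $d\mathbf{r}_s(T_s(S^1))$ is regarded as a one-dimensional linear subspace of $\mathbb{R}^2$ (identifying $T_{\mathbf{r}(s)}\mathbb{R}^2$ with $\mathbb{R}^2$), so that $\mathbf{r}(s)+d\mathbf{r}_s(T_s(S^1))$ is the affine tangent line at $\mathbf{r}(s)$. For a real number $\theta$, let $R_\theta:\mathbb{R}^2\to\mathbb{R}^2$ be the rotation $R_\theta(x,y)=(x\cos\theta-y\sin\theta,\ x\sin\theta+y\cos\theta)$ and define $$\mathcal{NS}_{\theta,\mathbf{r}}=\mathbb{R}^2-\bigcup_{s\in S^1}\left(\mathbf{r}(s)+R_\theta\left(d\mathbf{r}_s(T_s(S^1))\right)\right).$$ The set $\mathcal{NS}_{\mathbf{r}}=\mathcal{NS}_{0,\mathbf{r}}$ (the complement of the union of all tangent lines) is called the no-silhouette of $\mathbf{r}$; ''$\mathbf{r}$ has its no-silhouette'' means that it is non-empty. In that case the aperture angle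 $\theta_{\mathbf{r}}$ ($0<\theta_{\mathbf{r}}\le\frac{\pi}{2}$) is the largest angle such that $\mathcal{NS}_{\theta,\mathbf{r}}\neq\emptyset$ for every $\theta$ with $0\le\theta<\theta_{\mathbf{r}}$. An inflection point is a point of the curve at which the curvature vanishes. *)

(* Defs.v *)
From HB Require Import structures.
From mathcomp Require Import all_boot all_order all_algebra.
From mathcomp Require Import all_classical all_reals all_analysis.

Set Implicit Arguments.
Unset Strict Implicit.
Unset Printing Implicit Defensive.

Import Order.TTheory GRing.Theory Num.Theory.
Import numFieldNormedType.Exports.

Local Open Scope classical_set_scope.
Local Open Scope ring_scope.

Definition S1 (R : realType) : Type :=
  {p : R * R | p.1 ^+ 2 + p.2 ^+ 2 = 1}.

(* The covering of the circle by the line.  It is a local diffeomorphism onto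
   S1, so smoothness of a map on S1 and its differential can be read off from
   the composite with [circle]. *)
Definition circle (R : realType) (t : R) : S1 R :=
  exist _ (cos t, sin t) (cos2Dsin2 t).

Section Curve.
Variable R : realType.
Implicit Types (r : S1 R -> R * R) (s : S1 R) (t theta a : R) (w : R * R).

Definition pullback r : R -> R * R := r \o @circle R.

Definition smooth r : Prop := forall n t, derivable (derive1n n (pullback r)) t 1.

Definition velocity r t : R * R := derive1 (pullback r) t.

Definition acceleration r t : R * R := derive1n 2 (pullback r) t.

(* The differential of r at [circle t] sends a times the unit tangent vector
   (- sin t, cos t) of S1 to a times [velocity r t]; in particular it is
   injective exactly when [velocity r t] is nonzero. *)
Definition immersion r : Prop := smooth r /\ forall t, velocity r t != 0.

(* The image of the tangent line T_s(S1) under the differential of r at s;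
   the parameters t of a given s differ by multiples of 2 * pi and all give the
   same velocity. *)
Definition tangent_image r s : set (R * R) :=
  [set w | exists t a, circle t = s /\ w = a *: velocity r t].

Definition rotation theta (p : R * R) : R * R :=
  (p.1 * cos theta - p.2 * sin theta, p.1 * sin theta + p.2 * cos theta).

Definition NS theta r : set (R * R) :=
  ~` \bigcup_(s in [set: S1 R])
       [set r s + w | w in rotation theta @` tangent_image r s].

Definition no_silhouette r : set (R * R) := NS 0 r.

Definition aperture_candidates r : set R :=
  [set a | 0 < a <= pi / 2 /\
           forall theta, 0 <= theta < a -> NS theta r !=set0].

Definition is_aperture_angle r a : Prop :=
  aperture_candidates r a /\ ubound (aperture_candidates r) a.

(* Euclidean length, unlike the library norm of R * R, which is the maximum
   norm. *)
Definition length2 (v : R * R) : R := Num.sqrt (v.1 ^+ 2 + v.2 ^+ 2).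

(* Signed curvature det(r', r'') / |r'|^3. *)
Definition curvature r t : R :=
  let v := velocity r t in let g := acceleration r t in
  (v.1 * g.2 - v.2 * g.1) / length2 v ^+ 3.

Definition inflection_point r s : Prop :=
  exists t, circle t = s /\ curvature r t = 0.

End Curve.

(* Main.v *)
Require Import Defs.
From mathcomp Require Import all_boot all_order all_algebra.
From mathcomp Require Import all_classical all_reals all_analysis.
From mathcomp Require Import ring lra.

Import Order.TTheory GRing.Theory Num.Theory.
Import numFieldNormedType.Exports.
Local Open Scope classical_set_scope.
Local Open Scope ring_scope.

(** Put P at the origin, let c be the 2 pi-periodic parametrization with
velocity v and acceleration g, and set D = det (c, v), E = c . v.  The tangent
line at c rotated by theta passes through the origin exactly when
F_theta = D cos theta + E sin theta vanishes, so P lies in NS theta iff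
F_theta has no zero ([NS_iff_nonvanishing]).  In polar terms, if psi is the
angle from c to v, then F_theta = |c| |v| sin (psi + theta).

Suppose F_theta2 has no zero.  It then has a constant sign.  The point is that
D has no zero either, that is, psi cannot pass through a multiple of pi:
 - where D = 0, one has D' = det (c, g) and D' E = |c|^2 det (v, g).  Without
   inflection points det (v, g) has a constant sign, and there the sign of E is
   that of F_theta2; so D would cross 0 in the same direction at all its zeros
   ([smaller_angle_nonvanishing]);
 - a periodic function cannot cross 0 in one direction only
   ([periodic_upcrossing_nonvanishing]).
Hence D has a constant sign too.  By Rolle applied to |c|^2, E vanishes
somewhere ([closed_curve_radially_critical]); there F_theta2 = D cos theta2, so
D and F_theta2 have the same sign.  Finally
  sin theta2 F_theta1 = sin (theta2 - theta1) D + sin theta1 F_theta2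
exhibits F_theta1 as a combination, with nonnegative weights, of two functions
of the same sign, the weight of D being positive.

The signs of sin theta2 and cos theta2 come from
0 < theta2 < theta_r <= pi / 2. *)

(** * Derivatives and continuity *)

Lemma is_derive_continuous {R : realType} {V : normedModType R}
    (f df : R -> V) (f_df : forall x : R, is_derive x 1 f (df x)) : continuous f.
Proof.
move=> x; apply: differentiable_continuous; apply/derivable1_diffP.
exact: (@ex_derive _ _ _ _ _ _ _ (f_df x)).
Qed.

Lemma is_derive_fst {R : realType} {U V : normedModType R}
    (f : R -> U * V) (t : R) (df : U * V) :
  is_derive t 1 f df -> is_derive t 1 (fst \o f) df.1.
Proof.
move=> [fd fE].
have h : (h^-1 *: (((fst \o f) \o shift t) (h *: 1) - (fst \o f) t)
    @[h --> 0^']) --> df.1.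
  have H : (h^-1 *: ((f \o shift t) (h *: 1) - f t) @[h --> 0^']) --> df.
    by rewrite -fE; exact: fd.
  exact: (cvg_comp _ _ H cvg_fst).
by split; [apply/cvg_ex; exists df.1 | exact: cvg_lim].
Qed.

Lemma is_derive_snd {R : realType} {U V : normedModType R}
    (f : R -> U * V) (t : R) (df : U * V) :
  is_derive t 1 f df -> is_derive t 1 (snd \o f) df.2.
Proof.
move=> [fd fE].
have h : (h^-1 *: (((snd \o f) \o shift t) (h *: 1) - (snd \o f) t)
    @[h --> 0^']) --> df.2.
  have H : (h^-1 *: ((f \o shift t) (h *: 1) - f t) @[h --> 0^']) --> df.
    by rewrite -fE; exact: fd.
  exact: (cvg_comp _ _ H cvg_snd).
by split; [apply/cvg_ex; exists df.2 | exact: cvg_lim].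
Qed.

Lemma periodic_derive1 {R : realType} {V : normedModType R}
    (f : R -> V) (T : R) :
  periodic f T -> periodic (derive1 f) T.
Proof.
by move=> fT t; rewrite /derive1; under eq_fun do rewrite addrA !fT.
Qed.

(** * Sign changes and periodicity *)

Lemma nonvanishing_same_sign {R : realType} (f : R -> R)
    (f_cont : continuous f) (f_neq0 : forall x, f x != 0) (x y : R) :
  0 < f x * f y.
Proof.
wlog xy : x y / x <= y.
  by move=> H; case: (leP x y) => [|/ltW] xy; [|rewrite mulrC]; exact: H.
rewrite ltNge; apply/negP => fxy.
have [||c _ fc0] := @IVT R f x y 0 xy.
- exact: continuous_subspaceT.
- have := f_neq0 x; have := f_neq0 y.
  by case: (leP (f x) (f y)) => ? ? ?; apply/andP; split; nra.
- by have := f_neq0 c; rewrite fc0 eqxx.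
Qed.

(** By Caratheodory's form of the derivative, g y = q y * (y - m) with q
continuous and q m > 0, so g is positive just to the right of m. *)
Lemma positive_right_of_upcrossing {R : realType} (g : R -> R) (m x dg : R) :
  is_derive m 1 g dg -> g m = 0 -> 0 < dg -> m < x ->
  exists2 y, m < y < x & 0 < g y.
Proof.
move=> /is_derive1_caratheodory [q [gq q_cont <-]] gm0 q_gt0 mx.
have q_near : \forall y \near m^'+, 0 < q y.
  by apply: cvg_within; apply: cvgr_gt q_cont _ _.
have : \forall y \near m^'+, m < y < x /\ 0 < g y.
  near=> y.
  have my : m < y by near: y; exact: nbhs_right_gt.
  have yx : y < x by near: y; exact: nbhs_right_lt.
  split; first by rewrite my.
  have := gq y; rewrite gm0 subr0 => ->.
  by rewrite mulr_gt0 ?subr_gt0//; near: y.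
by move=> /filter_ex [y [? ?]]; exists y.
Unshelve. all: by end_near. Qed.

(** After an up-crossing zero a, the function g can never become negative: it
would have to come back through 0 after its last zero, where it goes up.  By
periodicity the zero a + T is then an interior minimum of g on ]a, a + 2 T[,
so dg vanishes there, which contradicts the up-crossing. *)
Lemma periodic_upcrossing_nonvanishing {R : realType} (g dg : R -> R) (T : R)
    (T_gt0 : 0 < T) (g_dg : forall x : R, is_derive x 1 g (dg x))
    (gT : periodic g T) (up : forall x, g x = 0 -> 0 < dg x) (a : R) :
  g a != 0.
Proof.
apply/negP => /eqP ga0.
have g_cont := is_derive_continuous _ _ g_dg.
have g_ge0 x : a <= x -> 0 <= g x.
  move=> ax; rewrite leNgt; apply/negP => gx_lt0.
  (* The last zero m of g on [a, x]: g is positive just after m and negative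
     at x, so it has a later zero. *)
  pose Z := `[a, x] `&` (g @^-1` [set 0]).
  have Z_compact : compact Z.
    apply: compact_closedI; first exact: segment_compact.
    by apply: closed_comp => [y _|]; [exact: g_cont | exact: closed_eq].
  have Za : Z a by split => //=; rewrite in_itv/= lexx.
  have [|||m mZ m_max] := @compact_EVT_max R R id Z.
  - by exists a.
  - exact: Z_compact.
  - by apply: continuous_subspaceT => y; exact: cvg_id.
  move: mZ; rewrite inE => -[/=]; rewrite in_itv/= => /andP[am mx] gm0.
  have m_lt_x : m < x.
    by rewrite lt_neqAle mx andbT; apply/eqP => mE; rewrite -mE gm0 ltxx in gx_lt0.
  have [y /andP[my yx] gy] :=
    positive_right_of_upcrossing _ _ _ _ (g_dg m) gm0 (up _ gm0) m_lt_x.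
  have [||z zI gz0] := @IVT R g y x 0 (ltW yx).
  - exact: continuous_subspaceT.
  - by rewrite ge_min le_max (ltW gy) (ltW gx_lt0) orbT.
  move: zI; rewrite in_itv/= => /andP[yz zx].
  have : z <= m.
    apply: (m_max z); rewrite inE; split => //=.
    by rewrite in_itv/= zx (le_trans am)// ltW// (lt_le_trans my).
  by rewrite leNgt (lt_le_trans my).
have b0 : g (a + T) = 0 by rewrite gT.
have [_ dE] : is_derive (a + T) (1 : R) g 0.
  apply: (@derive1_at_min R g a (a + T + T)).
  - lra.
  - by move=> t _; exact: (@ex_derive _ _ _ _ _ _ _ (g_dg t)).
  - by rewrite in_itv/=; apply/andP; split; lra.
  - by move=> t; rewrite in_itv/= => /andP[/ltW at_ _]; rewrite b0; exact: g_ge0.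
have [_ dE'] := g_dg (a + T).
by have := up _ b0; rewrite -dE' dE ltxx.
Qed.

(** The argument on the pair (D, E) alone, with F2 for F_theta2.  At a zero of D
the sign of F2 is that of E, so fixing the sign of D' E there fixes the direction
in which D crosses 0.  The factor k covers both orientations of the curve.  For a
curve D' E = |c|^2 det (v, g), and the premise F2 t != 0 of [crossing] is what
makes c nonzero. *)
Lemma smaller_angle_nonvanishing {R : realType} (D dD E : R -> R)
    (T k a theta1 theta2 : R)
    (T_gt0 : 0 < T) (D_dD : forall t : R, is_derive t 1 D (dD t))
    (E_cont : continuous E) (DT : periodic D T) (Ea0 : E a = 0)
    (crossing : forall t, D t = 0 -> D t * cos theta2 + E t * sin theta2 != 0 ->
       0 < k * (dD t * E t))
    (theta1_ge0 : 0 <= theta1) (theta12 : theta1 < theta2)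
    (theta2_lt : theta2 < pi / 2)
    (F2_neq0 : forall t, D t * cos theta2 + E t * sin theta2 != 0) (t : R) :
  D t * cos theta1 + E t * sin theta1 != 0.
Proof.
have pi0 := pi_gt0 R.
have s2 : 0 < sin theta2 by apply: sin_gt0_pihalf; apply/andP; split; lra.
have c2 : 0 < cos theta2 by apply: cos_gt0_pihalf; apply/andP; split; lra.
have s1 : 0 <= sin theta1 by apply: sin_ge0_pi; apply/andP; split; lra.
have s12 : 0 < sin (theta2 - theta1).
  by apply: sin_gt0_pi; apply/andP; split; lra.
have D_cont := is_derive_continuous _ _ D_dD.
pose F2 t := D t * cos theta2 + E t * sin theta2.
have F2_cont : continuous F2.
  by move=> x; apply: cvgD; apply: cvgMl; [exact: D_cont | exact: E_cont].
have F2_sign := nonvanishing_same_sign _ F2_cont F2_neq0.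
have D_neq0 x : D x != 0.
  apply/negP => /eqP Dx0.
  have k_neq0 : k != 0.
    by have := crossing x Dx0 (F2_neq0 x); case: eqP => // ->; rewrite mul0r ltxx.
  (* This multiple of D crosses 0 upwards at each of its zeros. *)
  pose j := k * F2 x.
  have j_neq0 : j != 0 by rewrite mulf_neq0// F2_neq0.
  have : j * D x != 0; last by rewrite Dx0 mulr0 eqxx.
  apply: (periodic_upcrossing_nonvanishing (fun y => j * D y)
    (fun y => j * dD y) T T_gt0).
  - by move=> y; rewrite /= DT.
  - move=> y /eqP; rewrite mulf_eq0 (negbTE j_neq0) => /eqP Dy.
    have := crossing y Dy (F2_neq0 y); have := F2_sign x y.
    rewrite {2}/F2 /= Dy mul0r add0r /j => h1 h2.
    have FE : 0 < F2 x * E y by rewrite -(pmulr_lgt0 _ s2) -mulrA.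
    have : 0 < (F2 x * E y) * (k * (dD y * E y)) by rewrite mulr_gt0.
    have -> : (F2 x * E y) * (k * (dD y * E y)) = k * F2 x * dD y * E y ^+ 2.
      by ring.
    by rewrite pmulr_lgt0// lt_neqAle sqr_ge0 andbT eq_sym sqrf_eq0;
      apply: contraTneq FE => ->; rewrite mulr0 ltxx.
(* At a, where E = 0, F2 is a positive multiple of D; the signs propagate. *)
have DF2 : 0 < D t * F2 t.
  have h1 := nonvanishing_same_sign _ D_cont D_neq0 t a.
  have h2 := F2_sign t a; rewrite {2}/F2 Ea0 mul0r addr0 mulrA in h2.
  have h3 : 0 < F2 t * D a by rewrite -(pmulr_lgt0 _ c2).
  have : 0 < (D t * D a) * (F2 t * D a) by rewrite mulr_gt0.
  have -> : (D t * D a) * (F2 t * D a) = D t * F2 t * D a ^+ 2 by ring.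
  by rewrite pmulr_lgt0// lt_neqAle sqr_ge0 andbT eq_sym sqrf_eq0.
apply/negP => /eqP F1_eq0.
have : sin theta2 * F2 t * (D t * cos theta1 + E t * sin theta1) =
    sin (theta2 - theta1) * (D t * F2 t) + sin theta1 * F2 t ^+ 2.
  by rewrite sinB /F2; ring.
rewrite F1_eq0 mulr0 => /eqP; rewrite eq_sym; apply/negP; rewrite gt_eqF//.
exact: ltr_pwDl (mulr_gt0 s12 DF2) (mulr_ge0 s1 (sqr_ge0 _)).
Qed.

(** * Determinant and dot product along plane curves *)

Definition dot {R : realType} (u w : R * R) : R := u.1 * w.1 + u.2 * w.2.

Definition det2 {R : realType} (u w : R * R) : R := u.1 * w.2 - u.2 * w.1.

Lemma is_derive_dot {R : realType} (u w : R -> R * R) (t : R) (du dw : R * R) :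
  is_derive t (1 : R) u du -> is_derive t (1 : R) w dw ->
  is_derive t (1 : R) (fun t => dot (u t) (w t)) (dot du (w t) + dot (u t) dw).
Proof.
move=> hu hw.
have u1 := is_derive_fst _ _ _ hu; have u2 := is_derive_snd _ _ _ hu.
have w1 := is_derive_fst _ _ _ hw; have w2 := is_derive_snd _ _ _ hw.
apply: (is_derive_eq (is_deriveD (is_deriveM u1 w1) (is_deriveM u2 w2))).
by rewrite /dot /GRing.scale/=; ring.
Qed.

Lemma is_derive_det2 {R : realType} (u w : R -> R * R) (t : R) (du dw : R * R) :
  is_derive t (1 : R) u du -> is_derive t (1 : R) w dw ->
  is_derive t (1 : R) (fun t => det2 (u t) (w t)) (det2 du (w t) + det2 (u t) dw).
Proof.
move=> hu hw.
have u1 := is_derive_fst _ _ _ hu; have u2 := is_derive_snd _ _ _ hu.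
have w1 := is_derive_fst _ _ _ hw; have w2 := is_derive_snd _ _ _ hw.
apply: (is_derive_eq (is_deriveB (is_deriveM u1 w2) (is_deriveM u2 w1))).
by rewrite /det2 /GRing.scale/=; ring.
Qed.

(** The squared distance |c|^2 to the origin is periodic, so Rolle gives a
critical point; its derivative is 2 (c . v). *)
Lemma closed_curve_radially_critical {R : realType} (c v : R -> R * R) (T : R)
    (T_gt0 : 0 < T) (c_v : forall t : R, is_derive t 1 c (v t))
    (cT : periodic c T) : exists a, dot (c a) (v a) = 0.
Proof.
have cc t := is_derive_dot _ _ _ _ _ (c_v t) (c_v t).
have [|||a aI [_ dE]] := @Rolle R (fun t => dot (c t) (c t)) 0 T T_gt0.
- by move=> t _; case: (cc t).
- by apply: continuous_subspaceT; exact: is_derive_continuous cc.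
- by rewrite -(cT 0) add0r.
exists a; have [_] := cc a; rewrite dE /dot => h.
lra.
Qed.

Lemma det2vv {R : realType} (u : R * R) : det2 u u = 0.
Proof. by rewrite /det2 mulrC subrr. Qed.

(** Gives the sign of D' E when D = 0: then u = c is parallel to v, and the
product is |c|^2 det (v, g).  Both sides are quadratic in u and invariant under
a common rotation of the three vectors, so it suffices to see it for
u = (1, 0). *)
Lemma det2_mul_dot {R : realType} (u v w : R * R) :
  det2 u w * dot u v = dot u u * det2 v w + det2 u v * dot u w.
Proof. by rewrite /det2 /dot; ring. Qed.

Lemma dotvv_gt0 {R : realType} (w : R * R) : w != 0 -> 0 < dot w w.
Proof.
move=> w_neq0; rewrite lt_neqAle addr_ge0 -?expr2 ?sqr_ge0// andbT eq_sym.
apply: contra w_neq0; rewrite /dot -!expr2 paddr_eq0 ?sqr_ge0// !sqrf_eq0.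
by move=> w0; rewrite -pair_eqE.
Qed.

Lemma det2_eq0_scale {R : realType} (u w : R * R) :
  w != 0 -> det2 u w = 0 -> u = (dot u w / dot w w) *: w.
Proof.
move=> /dotvv_gt0 w_gt0 uw0; apply: (scalerI (lt0r_neq0 w_gt0)).
rewrite scalerA mulrC divfK ?lt0r_neq0//; move: uw0.
case: u w {w_gt0} => [u1 u2] [w1 w2]; rewrite /det2 /dot /= => uw0.
congr pair; rewrite /= /GRing.scale/=.
  apply: subr0_eq; transitivity ((u1 * w2 - u2 * w1) * w2); first by ring.
  by rewrite uw0 mul0r.
apply: subr0_eq; transitivity ((u1 * w2 - u2 * w1) * - w1); first by ring.
by rewrite uw0 mul0r.
Qed.

Lemma rotationZ {R : realType} (theta a : R) (w : R * R) :
  rotation theta (a *: w) = a *: rotation theta w.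
Proof. by congr pair; rewrite /= /GRing.scale/=; ring. Qed.

Lemma dot_rotation {R : realType} (theta : R) (w : R * R) :
  dot (rotation theta w) (rotation theta w) = dot w w.
Proof.
rewrite -[RHS]mulr1 -(cos2Dsin2 theta) /dot /rotation/=; ring.
Qed.

Lemma det2_rotation {R : realType} (theta : R) (u w : R * R) :
  det2 u (rotation theta w) = det2 u w * cos theta + dot u w * sin theta.
Proof. by rewrite /det2 /dot /rotation/=; ring. Qed.

(** * Closed curves without inflection points *)

(** The left-hand side of the inequation is det (c, R_theta v), which vanishes
exactly when c is parallel to R_theta v, that is, when the rotated line at
[r (circle t)] contains P; the immersion hypothesis makes R_theta v nonzero. *)
Lemma NS_iff_nonvanishing {R : realType} (r : S1 R -> R * R) (theta : R)
    (P : R * R) (v_neq0 : forall t, velocity r t != 0) :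
  NS theta r P <->
  forall t, det2 (pullback r t - P) (velocity r t) * cos theta +
    dot (pullback r t - P) (velocity r t) * sin theta != 0.
Proof.
split=> [PNS t | F_neq0 [s _ [w [u [t [a [<- ->]]] <-] PE]]].
- apply/negP => /eqP; rewrite -det2_rotation => F0.
  apply: PNS; exists (circle t) => //.
  have Rv_neq0 : rotation theta (velocity r t) != 0.
    apply: contraTneq (dotvv_gt0 _ (v_neq0 t)) => Rv0.
    by rewrite -(dot_rotation theta) Rv0 /dot/= mul0r addr0 ltxx.
  have cE := det2_eq0_scale _ _ Rv_neq0 F0; set a := _ / _ in cE.
  exists (rotation theta (- a *: velocity r t)).
    by exists (- a *: velocity r t) => //; exists t, (- a).
  by rewrite rotationZ scaleNr -cE opprB addrC subrK.
- have /eqP := F_neq0 t; apply; rewrite -det2_rotation.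
  rewrite -PE rotationZ /pullback/= opprD addrA subrr add0r.
  by rewrite /det2/= /GRing.scale/=; ring.
Qed.

(** [smaller_angle_nonvanishing] for D = det (c, v) and E = c . v, with k the value
of det (v, g) at 0; dg is there for the continuity of g, on which the constant
sign of det (v, g) depends. *)
Lemma curve_smaller_angle_nonvanishing {R : realType}
    (c v g dg : R -> R * R) (T theta1 theta2 : R)
    (T_gt0 : 0 < T) (c_v : forall t : R, is_derive t 1 c (v t))
    (v_g : forall t : R, is_derive t 1 v (g t))
    (g_dg : forall t : R, is_derive t 1 g (dg t))
    (cT : periodic c T) (vT : periodic v T)
    (vg_neq0 : forall t, det2 (v t) (g t) != 0)
    (theta1_ge0 : 0 <= theta1) (theta12 : theta1 < theta2)
    (theta2_lt : theta2 < pi / 2)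
    (F2_neq0 : forall t,
      det2 (c t) (v t) * cos theta2 + dot (c t) (v t) * sin theta2 != 0)
    (t : R) :
  det2 (c t) (v t) * cos theta1 + dot (c t) (v t) * sin theta1 != 0.
Proof.
have D_dD s : is_derive s (1 : R) (fun s => det2 (c s) (v s)) (det2 (c s) (g s)).
  by have := is_derive_det2 _ _ _ _ _ (c_v s) (v_g s); rewrite det2vv add0r.
have E_cont := is_derive_continuous _ _
  (fun s => is_derive_dot _ _ _ _ _ (c_v s) (v_g s)).
have K_cont := is_derive_continuous _ _
  (fun s => is_derive_det2 _ _ _ _ _ (v_g s) (g_dg s)).
have K_sign := nonvanishing_same_sign _ K_cont vg_neq0 0.
have [a Ea0] := closed_curve_radially_critical _ _ _ T_gt0 c_v cT.
apply: (smaller_angle_nonvanishing _ _ _ T (det2 (v 0) (g 0)) a _ theta2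
  T_gt0 D_dD E_cont) => //.
- by move=> s; rewrite /= cT vT.
- move=> s /= D0; rewrite D0 mul0r add0r => Es.
  rewrite det2_mul_dot D0 mul0r addr0 mulrCA mulr_gt0//.
  apply: dotvv_gt0; apply: contraNneq Es => ->.
  by rewrite /dot/= !mul0r addr0 mul0r.
Qed.

Theorem theorem3 (R : realType) (r : S1 R -> R * R) (theta_r : R)
  (r_immersion : immersion r)
  (r_no_silhouette : no_silhouette r !=set0)
  (r_aperture : is_aperture_angle r theta_r)
  (r_no_inflection : forall s : S1 R, ~ inflection_point r s) :
  forall theta1 theta2 : R,
    0 <= theta1 -> theta1 < theta2 -> theta2 < theta_r ->
    NS theta2 r `<=` NS theta1 r.
Proof.
have [r_smooth v_neq0] := r_immersion.
have theta_r_le : theta_r <= pi / 2 by have [[/andP[]]] := r_aperture.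
move=> theta1 theta2 theta1_ge0 theta12 theta2_lt P.
move=> /(NS_iff_nonvanishing _ _ _ v_neq0) F2_neq0.
apply/(NS_iff_nonvanishing _ _ _ v_neq0).
pose c t := pullback r t - P.
pose v := velocity r; pose g := acceleration r.
have c_v t : is_derive t (1 : R) c (v t).
  rewrite -[v t]subr0; apply: is_deriveB.
  by split; [exact: (r_smooth 0%N) | rewrite -derive1E].
have v_g t : is_derive t (1 : R) v (g t).
  by split; [exact: (r_smooth 1%N) | rewrite -derive1E].
have g_dg t : is_derive t (1 : R) g (derive1 g t).
  by split; [exact: (r_smooth 2%N) | rewrite -derive1E].
have circleT (t : R) : circle (t + pi *+ 2) = circle t.
  by apply: eq_exist; rewrite sinD2pi cosD2pi.
have cT : periodic c (pi *+ 2) by move=> t; rewrite /c /pullback/= circleT.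
have vT : periodic v (pi *+ 2).
  by apply: periodic_derive1 => t; rewrite /pullback/= circleT.
have T_gt0 : 0 < pi *+ 2 :> R by rewrite pmulrn_lgt0 ?pi_gt0.
apply: (curve_smaller_angle_nonvanishing c v g _ _ _ _
  T_gt0 c_v v_g g_dg cT vT _ theta1_ge0 theta12 _ F2_neq0); last first.
  exact: lt_le_trans theta2_lt theta_r_le.
move=> t; apply/negP => /eqP vg0; apply: (r_no_inflection (circle t)).
exists t; split=> //; rewrite /curvature/=.
by move: vg0; rewrite /v /g /det2 => ->; rewrite mul0r.
Qed.
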